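(* Let $D$ be an integral domain. Assume that $\operatorname{Int}(D)$ is flat over $D$, or more generally that the $n$-th tensor power $\operatorname{Int}(D)^{\otimes n}$ of $\operatorname{Int}(D)$ over $D$ is $D$-torsion-free for $n\le 4$. Then $\operatorname{Int}(D)$ has a (necessarily unique) $D$-$D$-biring structure that is compatible with the $D$-$D$-biring structure on $D[X]$ if and only if for every $f\in\operatorname{Int}(D)$ the polynomials $f(X+Y)$ and $f(XY)$ both can be expressed as (finite) sums of polynomials of the form $g(X)h(Y)$ with $g,h\in\operatorname{Int}(D)$.
   Context: All rings and algebras are commutative with identity. For an integral domain $D$ with quotient field $K$, $\operatorname{Int}(D)=\{f\in K[X] : f(D)\subseteq D\}$. A $D$-module $M$ is $D$-torsion-free if $dm=0$ with $d\in D\setminus\{0\}$, $m\in M$ implies $m=0$. Birings. Let $A,B$ be rings. An $A$-$B$-biring is an $A$-algebra $S$ together with the structure on $S$ of a $B$-algebra object in the opposite category of the category of $A$-algebras. Explicitly, $S$ is equipped with $A$-algebra homomorphisms $\Delta^+,\Delta^\times: S\to S\otimes_A S$ (co-addition and co-multiplication) and a co-$B$-linear structure $\beta: B\to \operatorname{Hom}_A(S,A)$ (the set of $A$-algebra homomorphisms), satisfying the duals of the laws defining $B$-algebras. Equivalently, it is an $A$-algebra $S$ with a lift of the functor $\operatorname{Hom}_A(S,-)$ from $A$-algebras to sets to a functor from $A$-algebras to $B$-algebras. A homomorphism of $A$-$B$-birings is an $A$-algebra homomorphism compatible with $\Delta^+$, $\Delta^\times$ and $\beta$. The polynomial ring $A[X]$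 is an $A$-$A$-biring with $\Delta^+(X)=X\otimes1+1\otimes X$, $\Delta^\times(X)=X\otimes X$, $\beta(a)(f)=f(a)$. A $D$-$D$-biring structure on $\operatorname{Int}(D)$ is compatible with that on $D[X]$ if the inclusion $D[X]\to\operatorname{Int}(D)$ is a homomorphism of $D$-$D$-birings. *)

(* Defs.v *)
From HB Require Import structures.
From mathcomp Require Import all_boot all_algebra.
From mathcomp Require Import boolp.
Set Implicit Arguments.
Unset Strict Implicit.
Unset Printing Implicit Defensive.
Import GRing.Theory.
Local Open Scope ring_scope.
Local Open Scope quotient_scope.

Section TensorDef.
Variables (A : comNzRingType) (M N : lmodType A).

(* The congruence on formal finite sums of pairs (m, n) presenting M (x)_A N.
   No formal opposites are needed: (- m, n) is an inverse of (m, n). *)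
Inductive tensor_rel : seq (M * N) -> seq (M * N) -> Prop :=
| tensor_refl u : tensor_rel u u
| tensor_sym u v : tensor_rel u v -> tensor_rel v u
| tensor_trans v u w : tensor_rel u v -> tensor_rel v w -> tensor_rel u w
| tensor_cat u u' v v' :
    tensor_rel u u' -> tensor_rel v v' -> tensor_rel (u ++ v) (u' ++ v')
| tensor_catC u v : tensor_rel (u ++ v) (v ++ u)
| tensor_Dl m m' n : tensor_rel [:: (m + m', n)] [:: (m, n); (m', n)]
| tensor_Dr m n n' : tensor_rel [:: (m, n + n')] [:: (m, n); (m, n')]
| tensor_Z a m n : tensor_rel [:: (a *: m, n)] [:: (m, a *: n)]
| tensor_0 n : tensor_rel [:: (0, n)] [::].

Definition tensor_relb u v : bool := `[< tensor_rel u v >].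

Fact tensor_relb_equiv : equiv_class_of tensor_relb.
Proof.
split=> [u|u v|v u w].
- by apply/asboolP; apply: tensor_refl.
- by apply/asboolP/asboolP => ?; apply: tensor_sym.
- by move=> /asboolP uv /asboolP vw; apply/asboolP; apply: tensor_trans uv vw.
Qed.

Canonical tensor_equiv := EquivRelPack tensor_relb_equiv.

Definition tensor : Type := {eq_quot tensor_equiv}.
HB.instance Definition _ := Choice.on tensor.
HB.instance Definition _ := EqQuotient.on tensor.

Definition tpure (m : M) (n : N) : tensor := \pi_tensor [:: (m, n)].

Definition tensor_zero : tensor := \pi_tensor [::].
Definition tensor_add (x y : tensor) : tensor := \pi_tensor (repr x ++ repr y).
Definition tensor_opp (x : tensor) : tensor :=
  \pi_tensor [seq (- p.1, p.2) | p <- repr x].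
Definition tensor_scale (a : A) (x : tensor) : tensor :=
  \pi_tensor [seq (a *: p.1, p.2) | p <- repr x].

Lemma tensor_eqP u v : reflect (tensor_rel u v) (\pi_tensor u == \pi_tensor v).
Proof. by rewrite eqmodE; apply: asboolP. Qed.

Lemma tensor_pi_eq u v : tensor_rel u v -> \pi_tensor u = \pi_tensor v.
Proof. by move=> uv; apply/eqP/tensor_eqP. Qed.

Lemma tensor_pi_rel u v : \pi_tensor u = \pi_tensor v -> tensor_rel u v.
Proof. by move/eqP/tensor_eqP. Qed.

Lemma tensor_repr u : tensor_rel (repr (\pi_tensor u)) u.
Proof. by apply: tensor_pi_rel; rewrite reprK. Qed.

Lemma tensor_addE u v :
  tensor_add (\pi_tensor u) (\pi_tensor v) = \pi_tensor (u ++ v).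
Proof. by apply/tensor_pi_eq/tensor_cat; apply: tensor_repr. Qed.

Lemma tensor_map_rel (f : M -> M) :
    {morph f : m m' / m + m'} -> (forall a, {morph f : m / a *: m}) ->
  forall u v, tensor_rel u v ->
    tensor_rel [seq (f p.1, p.2) | p <- u] [seq (f p.1, p.2) | p <- v].
Proof.
move=> fD fZ u v; elim=> {u v} /=.
- by move=> u; apply: tensor_refl.
- by move=> u v _; apply: tensor_sym.
- by move=> v u w _ uv _; apply: tensor_trans uv.
- by move=> u u' v v' _ uv _ uv'; rewrite !map_cat; apply: tensor_cat.
- by move=> u v; rewrite !map_cat; apply: tensor_catC.
- by move=> m m' n; rewrite fD; apply: tensor_Dl.
- by move=> m n n'; apply: tensor_Dr.
- by move=> a m n; rewrite fZ; apply: tensor_Z.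
- move=> n; have -> : f 0 = 0 by rewrite -[0](scale0r 0) fZ !scale0r.
  exact: tensor_0.
Qed.

Lemma tensor_oppE u :
  tensor_opp (\pi_tensor u) = \pi_tensor [seq (- p.1, p.2) | p <- u].
Proof.
apply: tensor_pi_eq; apply: (tensor_map_rel (f := -%R)).
- exact: opprD.
- by move=> a m; rewrite scalerN.
- exact: tensor_repr.
Qed.

Lemma tensor_scaleE a u :
  tensor_scale a (\pi_tensor u) = \pi_tensor [seq (a *: p.1, p.2) | p <- u].
Proof.
apply: tensor_pi_eq; apply: (tensor_map_rel (f := *:%R a)).
- exact: scalerDr.
- by move=> b m; rewrite !scalerA mulrC.
- exact: tensor_repr.
Qed.

Fact tensor_addA : associative tensor_add.
Proof.
elim/quotW=> u; elim/quotW=> v; elim/quotW=> w.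
by rewrite (tensor_addE v w) (tensor_addE u v) !tensor_addE catA.
Qed.

Fact tensor_addC : commutative tensor_add.
Proof.
elim/quotW=> u; elim/quotW=> v; rewrite !tensor_addE.
exact/tensor_pi_eq/tensor_catC.
Qed.

Fact tensor_add0 : left_id tensor_zero tensor_add.
Proof. by elim/quotW=> u; rewrite tensor_addE. Qed.

Fact tensor_addN : left_inverse tensor_zero tensor_opp tensor_add.
Proof.
elim/quotW=> u; elim: u => [|[m n] u IHu]; first by rewrite tensor_oppE tensor_addE.
have -> : \pi_tensor ((m, n) :: u) = tensor_add (\pi_tensor [:: (m, n)]) (\pi_tensor u).
  by rewrite tensor_addE.
have -> : tensor_opp (tensor_add (\pi_tensor [:: (m, n)]) (\pi_tensor u))
  = tensor_add (\pi_tensor [:: (- m, n)]) (tensor_opp (\pi_tensor u)).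
  by rewrite tensor_addE !tensor_oppE tensor_addE.
rewrite -tensor_addA (tensor_addC _ (\pi_tensor u)) (tensor_addA (tensor_opp _)).
rewrite IHu tensor_add0 tensor_addE; apply: tensor_pi_eq => /=.
apply: tensor_trans (tensor_sym (tensor_Dl _ _ _)) _.
by rewrite addNr; apply: tensor_0.
Qed.

HB.instance Definition _ := GRing.isZmodule.Build tensor
  tensor_addA tensor_addC tensor_add0 tensor_addN.

Lemma tensor_piD u v : \pi_tensor u + \pi_tensor v = \pi_tensor (u ++ v).
Proof. exact: tensor_addE. Qed.

Fact tensor_scaleA a b x :
  tensor_scale a (tensor_scale b x) = tensor_scale (a * b) x.
Proof.
elim/quotW: x => u.
rewrite (tensor_scaleE b u) tensor_scaleE tensor_scaleE -map_comp.
by congr (\pi_tensor _); apply: eq_map => p /=; rewrite scalerA.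
Qed.

Fact tensor_scale1 : left_id 1 tensor_scale.
Proof.
elim/quotW=> u; rewrite tensor_scaleE -[in RHS](map_id u).
by congr (\pi_tensor _); apply: eq_map => -[m n] /=; rewrite scale1r.
Qed.

Fact tensor_scaleDr : right_distributive tensor_scale +%R.
Proof.
move=> a; elim/quotW=> u; elim/quotW=> v.
rewrite (tensor_piD u v) (tensor_scaleE a u) (tensor_scaleE a v).
by rewrite (tensor_scaleE a (_ ++ _)) map_cat [RHS]tensor_piD.
Qed.

Fact tensor_scaleDl x : {morph tensor_scale^~ x : a b / a + b}.
Proof.
elim/quotW: x => u a b; elim: u => [|[m n] u IHu].
  by rewrite !(tensor_scaleE _ [::]) [RHS]tensor_piD.
have -> : \pi_tensor ((m, n) :: u) = (\pi_tensor [:: (m, n)] : tensor) + \pi_tensor u.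
  by rewrite [RHS]tensor_piD.
rewrite !tensor_scaleDr IHu addrACA; congr (_ + _).
rewrite !(tensor_scaleE _ [:: (m, n)]) [RHS]tensor_piD /= scalerDl.
exact/tensor_pi_eq/tensor_Dl.
Qed.

HB.instance Definition _ := GRing.Zmodule_isLmodule.Build A tensor
  tensor_scaleA tensor_scale1 tensor_scaleDr tensor_scaleDl.

Lemma tensor_consE m n u : \pi_tensor ((m, n) :: u) = tpure m n + \pi_tensor u.
Proof. by rewrite [RHS]tensor_piD. Qed.

Lemma tensor_ind (P : tensor -> Prop) :
    P 0 -> (forall m n, P (tpure m n)) ->
    (forall x y, P x -> P y -> P (x + y)) ->
  forall x, P x.
Proof.
move=> P0 P1 PD; elim/quotW; elim=> [//|[m n] u IHu].
by rewrite tensor_consE; apply: PD.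
Qed.

Lemma tpureDl n : {morph tpure^~ n : m m' / m + m'}.
Proof. by move=> m m'; rewrite [RHS]tensor_piD; apply/tensor_pi_eq/tensor_Dl. Qed.

Lemma tpureDr m : {morph tpure m : n n' / n + n'}.
Proof. by move=> n n'; rewrite [RHS]tensor_piD; apply/tensor_pi_eq/tensor_Dr. Qed.

Lemma tpureZl a m n : tpure (a *: m) n = a *: tpure m n.
Proof. by rewrite [RHS]tensor_scaleE. Qed.

Lemma tpureZr a m n : tpure m (a *: n) = a *: tpure m n.
Proof. by rewrite -tpureZl; apply/tensor_pi_eq/tensor_sym/tensor_Z. Qed.

(* The linear map M (x) N -> P induced by a bilinear b (see tliftE); junk, as
   it depends on the choice of representatives, if b is not bilinear. *)
Definition tlift (P : lmodType A) (b : M -> N -> P) (x : tensor) : P :=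
  \sum_(p <- repr x) b p.1 p.2.

End TensorDef.

Section TensorLift.
Variables (A : comNzRingType) (M N P : lmodType A) (b : M -> N -> P).
Hypothesis b_bilin : bilinear_for *:%R *:%R b.

Let blinl a m m' n : b (a *: m + m') n = a *: b m n + b m' n.
Proof. exact: b_bilin.1. Qed.
Let blinr a m n n' : b m (a *: n + n') = a *: b m n + b m n'.
Proof. exact: b_bilin.2. Qed.
Let bDl n : {morph b^~ n : m m' / m + m'}.
Proof. by move=> m m'; have := blinl 1 m m' n; rewrite !scale1r. Qed.
Let bDr m : {morph b m : n n' / n + n'}.
Proof. by move=> n n'; have := blinr 1 m n n'; rewrite !scale1r. Qed.
Let b0l n : b 0 n = 0.
Proof. by apply: (addrI (b 0 n)); rewrite -bDl !addr0. Qed.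
Let b0r m : b m 0 = 0.
Proof. by apply: (addrI (b m 0)); rewrite -bDr !addr0. Qed.
Let bZl a m n : b (a *: m) n = a *: b m n.
Proof. by have := blinl a m 0 n; rewrite b0l !addr0. Qed.
Let bZr a m n : b m (a *: n) = a *: b m n.
Proof. by have := blinr a m n 0; rewrite b0r !addr0. Qed.

Lemma tlift_pi u : tlift b (\pi u) = \sum_(p <- u) b p.1 p.2.
Proof.
rewrite /tlift; move: (tensor_repr u); move: (repr _) => v.
elim=> {u v} //=.
- by move=> u v w _ -> _ ->.
- by move=> u u' v v' _ uv _ uv'; rewrite !big_cat /= uv uv'.
- by move=> u v; rewrite !big_cat /= addrC.
- by move=> m m' n; rewrite !big_cons !big_nil !addr0 bDl.
- by move=> m n n'; rewrite !big_cons !big_nil !addr0 bDr.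
- by move=> a m n; rewrite !big_seq1 /= bZl bZr.
- by move=> n; rewrite big_seq1 big_nil /= b0l.
Qed.

Lemma tliftE m n : tlift b (tpure m n) = b m n.
Proof. by rewrite tlift_pi big_seq1. Qed.

Lemma tlift_linear : linear (tlift b).
Proof.
move=> a; elim/quotW=> u; elim/quotW=> v.
rewrite [_ *: _]tensor_scaleE tensor_piD !tlift_pi big_cat /= big_map.
by rewrite scaler_sumr; congr (_ + _); apply: eq_bigr => p _ /=; rewrite bZl.
Qed.

Lemma tliftD : {morph tlift b : x y / x + y}.
Proof. by move=> x y; have := tlift_linear 1 x y; rewrite !scale1r. Qed.

Lemma tlift0 : tlift b 0 = 0.
Proof. by apply: (addrI (tlift b 0)); rewrite -tliftD !addr0. Qed.

Lemma tliftZ a x : tlift b (a *: x) = a *: tlift b x.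
Proof. by have := tlift_linear a x 0; rewrite tlift0 !addr0. Qed.

Lemma tlift_uniq (h : tensor M N -> P) :
  linear h -> (forall m n, h (tpure m n) = b m n) -> h =1 tlift b.
Proof.
move=> h_lin hE x.
have hD y z : h (y + z) = h y + h z by have := h_lin 1 y z; rewrite !scale1r.
elim/tensor_ind: x => [|m n|x y IHx IHy]; last by rewrite hD IHx IHy tliftD.
  by rewrite tlift0; apply: (addrI (h 0)); rewrite -hD !addr0.
by rewrite hE tliftE.
Qed.

End TensorLift.

Section TensorMaps.
Variable A : comNzRingType.
Implicit Types M N P Q : lmodType A.

Definition tmap M N P Q (f : M -> P) (g : N -> Q) : tensor M N -> tensor P Q :=
  tlift (fun m n => tpure (f m) (g n)).

Definition tswap M N : tensor M N -> tensor N M :=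
  tlift (fun m n => tpure n m).

Definition tassoc M N P : tensor (tensor M N) P -> tensor M (tensor N P) :=
  tlift (fun u p => tlift (fun m n => tpure m (tpure n p)) u).

(* The n-th tensor power, as M (x) (M (x) (... (M (x) A))). *)
Fixpoint tpow M (n : nat) : lmodType A :=
  if n is n'.+1 then tensor M (tpow M n') else A^o.

Definition flat M : Prop :=
  forall (N P : lmodType A) (f : {linear N -> P}),
    injective f -> injective (tmap (@idfun M) f).

Definition torsion_free M : Prop :=
  forall (a : A) (m : M), a != 0 -> a *: m = 0 -> m = 0.

End TensorMaps.

Section TensorRing.
Variables (A : comNzRingType) (S T : comAlgType A).
Implicit Types x y z : tensor S T.

Definition tensor_one : tensor S T := tpure 1 1.
Definition tensor_mul x y : tensor S T :=
  tlift (fun s t => tlift (fun s' t' => tpure (s * s') (t * t')) y) x.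

Let inner_bilin s t :
  bilinear_for *:%R *:%R (fun s' t' => tpure (s * s') (t * t') : tensor S T).
Proof.
split=> [t' a s1 s2|s' a t1 t2] /=.
- by rewrite mulrDr tpureDl -scalerAr tpureZl.
- by rewrite mulrDr tpureDr -scalerAr tpureZr.
Qed.

Let outer_bilin y : bilinear_for *:%R *:%R
  (fun s t => tlift (fun s' t' => tpure (s * s') (t * t')) y : tensor S T).
Proof.
split=> [t a s1 s2|s a t1 t2] /=; elim/tensor_ind: y => [|s' t'|x y IHx IHy].
- by rewrite !tlift0 // scaler0 addr0.
- by rewrite !tliftE // mulrDl tpureDl -scalerAl tpureZl.
- by rewrite !tliftD // IHx IHy scalerDr addrACA.
- by rewrite !tlift0 // scaler0 addr0.
- by rewrite !tliftE // mulrDl tpureDr -scalerAl tpureZr.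
- by rewrite !tliftD // IHx IHy scalerDr addrACA.
Qed.

Lemma tensor_mulE s t s' t' :
  tensor_mul (tpure s t) (tpure s' t') = tpure (s * s') (t * t').
Proof. by rewrite /tensor_mul !tliftE. Qed.

Let mulDl : left_distributive tensor_mul +%R.
Proof. by move=> x y z; rewrite /tensor_mul tliftD. Qed.

Let mul0 y : tensor_mul 0 y = 0.
Proof. by rewrite /tensor_mul tlift0. Qed.

Let mulZ a x y : tensor_mul (a *: x) y = a *: tensor_mul x y.
Proof. by rewrite /tensor_mul tliftZ. Qed.

Let mulDr : right_distributive tensor_mul +%R.
Proof.
move=> x y z; elim/tensor_ind: x => [|s t|x x' IHx IHx']; first by rewrite !mul0 addr0.
  by rewrite /tensor_mul !(tliftE (outer_bilin _)) tliftD.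
by rewrite !mulDl IHx IHx' addrACA.
Qed.

Fact tensor_mulC : commutative tensor_mul.
Proof.
move=> x y; have mulr0 z : tensor_mul z 0 = 0.
  by apply: (addrI (tensor_mul z 0)); rewrite -mulDr !addr0.
elim/tensor_ind: x => [|s t|x x' IHx IHx']; first by rewrite mul0 mulr0.
  elim/tensor_ind: y => [|s' t'|y y' IHy IHy']; first by rewrite mul0 mulr0.
    by rewrite !tensor_mulE mulrC (mulrC t).
  by rewrite mulDr mulDl IHy IHy'.
by rewrite mulDr mulDl IHx IHx'.
Qed.

Fact tensor_mulA : associative tensor_mul.
Proof.
have mulr0 z : tensor_mul z 0 = 0 by rewrite tensor_mulC mul0.
move=> x y z; elim/tensor_ind: x => [|s t|x x' IHx IHx']; first by rewrite !mul0.
  elim/tensor_ind: y => [|s' t'|y y' IHy IHy']; first by rewrite mul0 mulr0 mul0.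
    elim/tensor_ind: z => [|s2 t2|z z' IHz IHz']; first by rewrite !mulr0.
      by rewrite !tensor_mulE !mulrA.
    by rewrite !mulDr IHz IHz'.
  by rewrite mulDr !mulDl mulDr IHy IHy'.
by rewrite !mulDl IHx IHx'.
Qed.

Fact tensor_mul1 : left_id tensor_one tensor_mul.
Proof.
elim/tensor_ind=> [|s t|x y IHx IHy]; first by rewrite tensor_mulC mul0.
  by rewrite tensor_mulE !mul1r.
by rewrite mulDr IHx IHy.
Qed.

HB.instance Definition _ := GRing.Zmodule_isComPzRing.Build (tensor S T)
  tensor_mulA tensor_mulC tensor_mul1 mulDl.

Lemma tensor1E : 1 = tpure 1 1 :> tensor S T.
Proof. by []. Qed.

Lemma tpureM s t s' t' :
  (tpure s t : tensor S T) * tpure s' t' = tpure (s * s') (t * t').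
Proof. exact: tensor_mulE. Qed.

Lemma tensor_scalerAl a x y : a *: (x * y) = a *: x * y.
Proof. by rewrite [RHS]mulZ. Qed.

End TensorRing.

(* S (x) T may be the zero ring, but S (x) S is not, as it maps onto S, so it is
   an algebra in the sense of the library. *)
Section TensorSquare.
Variables (A : comNzRingType) (S : comAlgType A).

Fact tensor_sq_nonzero : (1 : tensor S S) != 0.
Proof.
have mul_bilin : bilinear_for *:%R *:%R (fun s t : S => s * t).
  split=> [t a s1 s2|s a t1 t2] /=.
    by rewrite mulrDl -scalerAl.
  by rewrite mulrDr -scalerAr.
apply/eqP => /(congr1 (tlift (fun s t : S => s * t))).
rewrite tensor1E tliftE // tlift0 // mulr1 => /eqP.
by rewrite oner_eq0.
Qed.

HB.instance Definition _ :=
  GRing.PzSemiRing_isNonZero.Build (tensor S S) tensor_sq_nonzero.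
HB.instance Definition _ := GRing.Lmodule_isLalgebra.Build A (tensor S S)
  (@tensor_scalerAl A S S).
HB.instance Definition _ := GRing.Lalgebra_isComAlgebra.Build A (tensor S S).

End TensorSquare.

(* An A-B-biring structure on S: colin is beta : B -> Hom_A(S, A), and the
   cozero and the counit of comultiplication are beta 0 and beta 1. *)
Record biring (A B : comNzRingType) (S : comAlgType A) := Biring {
  coadd : {lrmorphism S -> tensor S S};
  comul : {lrmorphism S -> tensor S S};
  colin : B -> {lrmorphism S -> A | *%R};
  coaddA : forall s,
    tassoc (tmap coadd idfun (coadd s)) = tmap idfun coadd (coadd s);
  coaddC : forall s, tswap (coadd s) = coadd s;
  coadd0 : forall s, tlift (fun s1 s2 : S => colin 0 s1 *: s2) (coadd s) = s;
  coaddN : exists sigma : {lrmorphism S -> S}, forall s,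
    tlift (fun s1 s2 : S => sigma s1 * s2) (coadd s) = (colin 0 s)%:A;
  comulA : forall s,
    tassoc (tmap comul idfun (comul s)) = tmap idfun comul (comul s);
  comulC : forall s, tswap (comul s) = comul s;
  comul1 : forall s, tlift (fun s1 s2 : S => colin 1 s1 *: s2) (comul s) = s;
  (* the dual of x (y + z) = x y + x z *)
  comulDr : forall s,
    tmap idfun coadd (comul s)
    = tlift (fun u v : tensor S S =>
               tlift (fun x y => tlift (fun x' z =>
                 tpure (x * x') (tpure y z)) v) u)
            (tmap comul comul (coadd s));
  colinD : forall b c s,
    colin (b + c) s
    = tlift (fun s1 s2 : S => colin b s1 * colin c s2 : A^o) (coadd s);
  colinM : forall b c s,
    colin (b * c) s
    = tlift (fun s1 s2 : S => colin b s1 * colin c s2 : A^o) (comul s)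
}.

Arguments coadd {A B S} _.
Arguments comul {A B S} _.
Arguments colin {A B S} _ _.

(* Equality of the structure maps; the other fields are properties. *)
Definition same_biring (A B : comNzRingType) (S : comAlgType A)
    (B1 B2 : biring B S) : Prop :=
  [/\ coadd B1 =1 coadd B2, comul B1 =1 comul B2
    & forall b, colin B1 b =1 colin B2 b].

Definition biring_hom (A B : comNzRingType) (S T : comAlgType A)
    (BS : biring B S) (BT : biring B T) (phi : {lrmorphism S -> T}) : Prop :=
  [/\ forall s, tmap phi phi (coadd BS s) = coadd BT (phi s),
      forall s, tmap phi phi (comul BS s) = comul BT (phi s)
    & forall b s, colin BT b (phi s) = colin BS b s].

Section TensorFunctor.
Variable A : comNzRingType.

Lemma tlift_param (M N P Q : lmodType A) (c : Q -> M -> N -> P) :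
    (forall q, bilinear_for *:%R *:%R (c q)) ->
    (forall m n, linear (fun q => c q m n)) ->
  forall u, linear (fun q => tlift (c q) u).
Proof.
move=> c_bilin c_lin u a q q'; elim/tensor_ind: u => [|m n|u v IHu IHv].
- by rewrite !tlift0 // scaler0 addr0.
- by rewrite !tliftE //; apply: c_lin.
- by rewrite !tliftD // IHu IHv scalerDr addrACA.
Qed.

Lemma tpure_bilin (M N P Q : lmodType A) (f : {linear M -> P}) (g : {linear N -> Q}) :
  bilinear_for *:%R *:%R (fun m n => tpure (f m) (g n)).
Proof.
split=> [n a m m'|m a n n'] /=.
- by rewrite linearP tpureDl tpureZl.
- by rewrite linearP tpureDr tpureZr.
Qed.

Lemma tmapE (M N P Q : lmodType A) (f : {linear M -> P}) (g : {linear N -> Q}) m n :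
  tmap f g (tpure m n) = tpure (f m) (g n).
Proof. by rewrite /tmap tliftE //; apply: tpure_bilin. Qed.

Lemma tmap_linear (M N P Q : lmodType A) (f : {linear M -> P}) (g : {linear N -> Q}) :
  linear (tmap f g).
Proof. by apply: tlift_linear; apply: tpure_bilin. Qed.

Lemma tswap_bilin (M N : lmodType A) :
  bilinear_for *:%R *:%R (fun (m : M) (n : N) => tpure n m).
Proof.
split=> [n a m m'|m a n n'] /=.
- by rewrite tpureDr tpureZr.
- by rewrite tpureDl tpureZl.
Qed.

Lemma tswapE (M N : lmodType A) (m : M) (n : N) : tswap (tpure m n) = tpure n m.
Proof. by rewrite /tswap tliftE //; apply: tswap_bilin. Qed.

Lemma tassoc_inner_bilin (M N P : lmodType A) (p : P) :
  bilinear_for *:%R *:%R (fun (m : M) (n : N) => tpure m (tpure n p)).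
Proof.
split=> [n a m m'|m a n n'] /=.
- by rewrite tpureDl tpureZl.
- by rewrite tpureDl tpureZl tpureDr tpureZr.
Qed.

Lemma tassoc_bilin (M N P : lmodType A) : bilinear_for *:%R *:%R
  (fun (u : tensor M N) (p : P) => tlift (fun m n => tpure m (tpure n p)) u).
Proof.
split=> [p|u] /=; first exact/tlift_linear/tassoc_inner_bilin.
apply: tlift_param => [p|m n a p p']; first exact: tassoc_inner_bilin.
by rewrite !(tpureDr, tpureZr).
Qed.

Lemma tassocE (M N P : lmodType A) (m : M) (n : N) (p : P) :
  tassoc (tpure (tpure m n) p) = tpure m (tpure n p).
Proof.
rewrite /tassoc tliftE; last exact: tassoc_bilin.
by rewrite tliftE //; apply: tassoc_inner_bilin.
Qed.

Lemma tlift_mul (S T : comAlgType A) (P : lmodType A) (mu : P -> P -> P)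
    (b : S -> T -> P) :
    bilinear_for *:%R *:%R mu -> bilinear_for *:%R *:%R b ->
    (forall s t s' t', b (s * s') (t * t') = mu (b s t) (b s' t')) ->
  {morph tlift b : x y / x * y >-> mu x y}.
Proof.
move=> mu_bilin b_bilin bM.
have muDl p q r : mu (p + q) r = mu p r + mu q r.
  have : mu (1 *: p + q) r = 1 *: mu p r + mu q r := mu_bilin.1 r 1 p q.
  by rewrite !scale1r.
have muDr p q r : mu p (q + r) = mu p q + mu p r.
  have : mu p (1 *: q + r) = 1 *: mu p q + mu p r := mu_bilin.2 p 1 q r.
  by rewrite !scale1r.
have mu0l p : mu 0 p = 0 by apply: (addrI (mu 0 p)); rewrite -muDl !addr0.
have mu0r p : mu p 0 = 0 by apply: (addrI (mu p 0)); rewrite -muDr !addr0.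
move=> x y; elim/tensor_ind: x => [|s t|x x' IHx IHx'].
- by rewrite mul0r !tlift0 // mu0l.
- elim/tensor_ind: y => [|s' t'|y y' IHy IHy'].
  + by rewrite mulr0 !tlift0 // mu0r.
  + by rewrite tpureM !tliftE.
  + by rewrite mulrDr !(tliftD b_bilin) IHy IHy' muDr.
- by rewrite mulrDl !(tliftD b_bilin) IHx IHx' muDl.
Qed.

Lemma tensor_mul_bilin (S T : comAlgType A) :
  bilinear_for *:%R *:%R (fun x y : tensor S T => x * y).
Proof.
split=> [y a x x'|x a y y'] /=.
- by rewrite mulrDl tensor_scalerAl.
- by rewrite mulrDr; congr (_ + _); rewrite mulrC -tensor_scalerAl mulrC.
Qed.

Lemma alg_mul_bilin (S : comAlgType A) :
  bilinear_for *:%R *:%R (fun x y : S => x * y).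
Proof.
split=> [y a x x'|x a y y'] /=.
- by rewrite mulrDl scalerAl.
- by rewrite mulrDr scalerAr.
Qed.

(* A linear multiplicative map on A[X] is determined by the images of 1 and X. *)
Lemma poly_hom_ext (P : lmodType A) (mu : P -> P -> P) (g h : {poly A} -> P) :
    linear g -> linear h ->
    {morph g : x y / x * y >-> mu x y} -> {morph h : x y / x * y >-> mu x y} ->
    g 1 = h 1 -> g 'X = h 'X ->
  g =1 h.
Proof.
move=> g_lin h_lin gM hM gh1 ghX.
have lin0 (k : {poly A} -> P) : linear k -> k 0 = 0.
  move=> k_lin; apply: (addrI (k 0)).
  by have := k_lin 1 0 0; rewrite !scale1r !addr0.
have linS (k : {poly A} -> P) p c : linear k -> {morph k : x y / x * y >-> mu x y} ->
    k (p * 'X + c%:P) = mu (k p) (k 'X) + c *: k 1.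
  move=> k_lin kM; have := k_lin 1 (p * 'X) (c%:P); rewrite !scale1r kM => ->.
  congr (_ + _); have := k_lin c 1 0; rewrite (lin0 k) // !addr0 => <-.
  by rewrite alg_polyC.
by elim/poly_ind => [|p c IHp]; rewrite ?lin0 // !linS // IHp gh1 ghX.
Qed.

End TensorFunctor.

Definition mul_linear (A : comNzRingType) (M N : lmodType A)
    (h : M -> N) (muM : M -> M -> M) (muN : N -> N -> N) : Prop :=
  linear h /\ {morph h : x y / muM x y >-> muN x y}.

Section MulLinear.
Variable A : comNzRingType.

Lemma mul_linear_comp (M N P : lmodType A) (muM : M -> M -> M) (muN : N -> N -> N)
    (muP : P -> P -> P) (g : N -> P) (h : M -> N) :
  mul_linear g muN muP -> mul_linear h muM muN ->
  mul_linear (fun x => g (h x)) muM muP.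
Proof.
move=> [g_lin gM] [h_lin hM]; split=> [a x y|x y]; first by rewrite h_lin g_lin.
by rewrite hM gM.
Qed.

Lemma mul_linear_lrmorphism (S T : comAlgType A) (h : {lrmorphism S -> T}) :
  mul_linear h *%R *%R.
Proof. by split; [apply: linearP | apply: rmorphM]. Qed.

Lemma mul_linear_tlift (S T : comAlgType A) (P : lmodType A) (mu : P -> P -> P)
    (b : S -> T -> P) :
    bilinear_for *:%R *:%R mu -> bilinear_for *:%R *:%R b ->
    (forall s t s' t', b (s * s') (t * t') = mu (b s t) (b s' t')) ->
  mul_linear (tlift b) *%R mu.
Proof.
by move=> *; split; [apply: tlift_linear | apply: tlift_mul].
Qed.

Lemma mul_linear_tmap (S T S' T' : comAlgType A)
    (f : {lrmorphism S -> S'}) (g : {lrmorphism T -> T'}) :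
  mul_linear (tmap f g) *%R *%R.
Proof.
apply: mul_linear_tlift; first exact: tensor_mul_bilin.
  exact: (@tpure_bilin _ _ _ _ _ f g).
by move=> s t s' t'; rewrite !rmorphM tpureM.
Qed.

Lemma mul_linear_tassoc (S : comAlgType A) :
  mul_linear (@tassoc A S S S) *%R *%R.
Proof.
apply: mul_linear_tlift; first exact: tensor_mul_bilin.
  exact: tassoc_bilin.
have tb r := @tassoc_inner_bilin A S S S r.
move=> u p v q; elim/tensor_ind: u => [|m n|u u' IHu IHu'].
- by rewrite !(mul0r, tlift0) //; exact: tassoc_inner_bilin.
- elim/tensor_ind: v => [|m' n'|v v' IHv IHv'].
  + by rewrite mulr0 (tlift0 (tb _)) (tlift0 (tb _)) mulr0.
  + by rewrite tpureM !(tliftE (tb _)) !tpureM.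
  + by rewrite mulrDr !(tliftD (tb _)) IHv IHv' mulrDr.
- by rewrite mulrDl !(tliftD (tb _)) IHu IHu' mulrDl.
Qed.

Lemma mul_linear_tswap (S : comAlgType A) : mul_linear (@tswap A S S) *%R *%R.
Proof.
apply: mul_linear_tlift; first exact: tensor_mul_bilin.
  exact: tswap_bilin.
by move=> s t s' t'; rewrite tpureM.
Qed.

End MulLinear.

Section PolyEval.
Variables (A : comNzRingType) (S : comAlgType A) (x : S).

(* horner_alg with its linearity stated for the scaling of S: the library
   instance is linear for in_alg S \; *%R. *)
Definition poly_ev : {poly A} -> S := horner_alg x.

HB.instance Definition _ := GRing.RMorphism.copy poly_ev (horner_alg x).

Fact poly_ev_scalable : scalable poly_ev.
Proof. by move=> a p; rewrite /poly_ev linearZ /= mulr_algl. Qed.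

HB.instance Definition _ :=
  GRing.isScalable.Build A {poly A} S *:%R poly_ev poly_ev_scalable.

Lemma poly_evX : poly_ev 'X = x.
Proof. exact: horner_algX. Qed.

End PolyEval.

Section PolyBiring.
Variable A : comNzRingType.
Local Notation S := {poly A}.

Definition poly_coadd : {lrmorphism S -> tensor S S} :=
  poly_ev (tpure 'X 1 + tpure 1 'X : tensor S S).
Definition poly_comul : {lrmorphism S -> tensor S S} :=
  poly_ev (tpure 'X 'X : tensor S S).
Definition poly_colin (a : A) : {lrmorphism S -> A | *%R} := horner_eval a.

Let coaddX : poly_coadd 'X = tpure 'X 1 + tpure 1 'X.
Proof. exact: poly_evX. Qed.
Let comulX : poly_comul 'X = tpure 'X 'X.
Proof. exact: poly_evX. Qed.
Let colinE a p : poly_colin a p = p.[a].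
Proof. by []. Qed.

Let hom_lr (T : comAlgType A) (h : {lrmorphism S -> T}) :=
  @mul_linear_lrmorphism A S T h.

Let ext (P : lmodType A) (mu : P -> P -> P) (g h : S -> P) :
  mul_linear g *%R mu -> mul_linear h *%R mu ->
  g 1 = h 1 -> g 'X = h 'X -> g =1 h.
Proof. by move=> [gl gM] [hl hM]; apply: poly_hom_ext gl hl gM hM. Qed.

Let addlin (M N : lmodType A) (h : M -> N) :
  linear h -> {morph h : x y / x + y}.
Proof. by move=> hl x y; have := hl 1 x y; rewrite !scale1r. Qed.

Let tassocD : {morph @tassoc A S S S : x y / x + y}.
Proof. exact/addlin/tlift_linear/tassoc_bilin. Qed.
Let tswapD : {morph @tswap A S S : x y / x + y}.
Proof. exact/addlin/tlift_linear/tswap_bilin. Qed.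

Fact poly_coassoc (f : {lrmorphism S -> tensor S S}) :
    tassoc (tmap f idfun (f 'X)) = tmap idfun f (f 'X) ->
  forall s, tassoc (tmap f idfun (f s)) = tmap idfun f (f s).
Proof.
move=> fX; apply: (@ext (tensor S (tensor S S)) *%R) => //.
- apply: (mul_linear_comp (mul_linear_tassoc S)).
  exact: (mul_linear_comp (mul_linear_tmap f idfun) (hom_lr f)).
- exact: (mul_linear_comp (mul_linear_tmap idfun f) (hom_lr f)).
- by rewrite rmorph1 tensor1E !(tmapE f idfun, tmapE idfun f) rmorph1 tassocE.
Qed.

Fact poly_coaddA s :
  tassoc (tmap poly_coadd idfun (poly_coadd s))
  = tmap idfun poly_coadd (poly_coadd s).
Proof.
move: s; apply: poly_coassoc; rewrite coaddX.
rewrite (addlin (tmap_linear poly_coadd idfun)) (addlin (tmap_linear idfun poly_coadd)).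
rewrite !(tmapE poly_coadd idfun, tmapE idfun poly_coadd) /= coaddX !rmorph1.
by rewrite (tassocD (tpure (_ + _) 1)) tpureDl tassocD !tassocE tpureDr addrA.
Qed.

Fact poly_comulA s :
  tassoc (tmap poly_comul idfun (poly_comul s))
  = tmap idfun poly_comul (poly_comul s).
Proof.
move: s; apply: poly_coassoc; rewrite comulX.
by rewrite !(tmapE poly_comul idfun, tmapE idfun poly_comul) /= comulX tassocE.
Qed.

Fact poly_cocomm (f : {lrmorphism S -> tensor S S}) :
  tswap (f 'X) = f 'X -> forall s, tswap (f s) = f s.
Proof.
move=> fX; apply: (@ext (tensor S S) *%R) => //.
- exact: (mul_linear_comp (mul_linear_tswap S) (hom_lr f)).
- exact: hom_lr.
- by rewrite rmorph1 tensor1E tswapE.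
Qed.

Fact poly_coaddC s : tswap (poly_coadd s) = poly_coadd s.
Proof.
move: s; apply: poly_cocomm; rewrite coaddX.
by rewrite tswapD !tswapE addrC.
Qed.

Fact poly_comulC s : tswap (poly_comul s) = poly_comul s.
Proof. by move: s; apply: poly_cocomm; rewrite comulX tswapE. Qed.

Let counit_bilin a :
  bilinear_for *:%R *:%R (fun s1 s2 : S => poly_colin a s1 *: s2).
Proof.
split=> [s b x y|s b x y] /=.
- by rewrite !colinE hornerD hornerZ scalerDl scalerA.
- by rewrite scalerDr !scalerA mulrC.
Qed.

Fact poly_counit a (f : {lrmorphism S -> tensor S S}) :
    tlift (fun s1 s2 : S => poly_colin a s1 *: s2) (f 'X) = 'X ->
  forall s, tlift (fun s1 s2 : S => poly_colin a s1 *: s2) (f s) = s.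
Proof.
move=> fX; apply: (@ext S *%R _ idfun) => //.
- apply: (mul_linear_comp _ (hom_lr f)).
  apply: mul_linear_tlift; [exact: alg_mul_bilin | exact: counit_bilin |].
  move=> s t s' t'; rewrite !colinE hornerM.
  by rewrite -scalerAl -scalerAr scalerA.
- by rewrite rmorph1 tensor1E (tliftE (counit_bilin a)) colinE hornerE scale1r.
Qed.

Fact poly_coadd0 s : tlift (fun s1 s2 : S => poly_colin 0 s1 *: s2) (poly_coadd s) = s.
Proof.
move: s; apply: poly_counit; rewrite coaddX (tliftD (counit_bilin 0)).
by rewrite !(tliftE (counit_bilin 0)) !colinE !hornerE scale0r scale1r add0r.
Qed.

Fact poly_comul1 s : tlift (fun s1 s2 : S => poly_colin 1 s1 *: s2) (poly_comul s) = s.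
Proof.
move: s; apply: poly_counit; rewrite comulX.
by rewrite !(tliftE (counit_bilin 1)) !colinE !hornerE scale1r.
Qed.

Fact poly_coaddN : exists sigma : {lrmorphism S -> S}, forall s,
  tlift (fun s1 s2 : S => sigma s1 * s2) (poly_coadd s) = (poly_colin 0 s)%:A.
Proof.
pose sigma : {lrmorphism S -> S} := poly_ev (- 'X : S); exists sigma.
have sb : bilinear_for *:%R *:%R (fun s1 s2 : S => sigma s1 * s2).
  split=> [s b x y|s b x y] /=; first by rewrite linearP mulrDl scalerAl.
  by rewrite mulrDr scalerAr.
apply: (@ext S *%R).
- apply: (mul_linear_comp _ (hom_lr poly_coadd)).
  apply: mul_linear_tlift; [exact: alg_mul_bilin | exact: sb |].
  by move=> s t s' t'; rewrite rmorphM mulrACA.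
- split=> [a x y|x y]; rewrite !colinE.
    by rewrite hornerD hornerZ scalerDl scalerA.
  by rewrite hornerM -scalerAl mul1r scalerA.
- by rewrite rmorph1 tensor1E (tliftE sb) !rmorph1 mulr1 scale1r.
- rewrite coaddX (tliftD sb) !(tliftE sb) rmorph1 mulr1 mul1r [sigma _]poly_evX addNr.
  by rewrite colinE hornerX scale0r.
Qed.

Let pair_bilin a b :
  bilinear_for *:%R *:%R (fun s1 s2 : S => poly_colin a s1 * poly_colin b s2 : A^o).
Proof.
split=> [s c x y|s c x y] /=; rewrite !colinE hornerD hornerZ.
- by rewrite mulrDl -mulrA.
- by rewrite mulrDr mulrCA.
Qed.

Fact poly_colin_op a b c (f : {lrmorphism S -> tensor S S}) :
    tlift (fun s1 s2 : S => poly_colin a s1 * poly_colin b s2 : A^o) (f 'X) = c ->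
  forall s, poly_colin c s
    = tlift (fun s1 s2 : S => poly_colin a s1 * poly_colin b s2 : A^o) (f s).
Proof.
move=> fX; apply: (@ext A^o *%R).
- split=> [d x y|x y]; rewrite !colinE ?hornerM //.
  by rewrite hornerD hornerZ.
- apply: (mul_linear_comp _ (hom_lr f)).
  apply: (@mul_linear_tlift A S S A^o *%R); [exact: (alg_mul_bilin A^o) | exact: pair_bilin |].
  by move=> s t s' t'; rewrite !colinE !hornerM mulrACA.
- by rewrite colinE rmorph1 tensor1E (tliftE (pair_bilin a b)) !colinE !hornerE.
- by rewrite colinE hornerX fX.
Qed.

Fact poly_colinD a b s : poly_colin (a + b) s
  = tlift (fun s1 s2 : S => poly_colin a s1 * poly_colin b s2 : A^o) (poly_coadd s).
Proof.
move: s; apply: poly_colin_op; rewrite coaddX (tliftD (pair_bilin a b)).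
by rewrite !(tliftE (pair_bilin a b)) !colinE !hornerE.
Qed.

Fact poly_colinM a b s : poly_colin (a * b) s
  = tlift (fun s1 s2 : S => poly_colin a s1 * poly_colin b s2 : A^o) (poly_comul s).
Proof.
move: s; apply: poly_colin_op; rewrite comulX.
by rewrite !(tliftE (pair_bilin a b)) !colinE !hornerE.
Qed.

Let dist (u v : tensor S S) : tensor S (tensor S S) :=
  tlift (fun x y => tlift (fun x' z => tpure (x * x') (tpure y z)) v) u.

Let dist_in x y : bilinear_for *:%R *:%R
  (fun x' z : S => tpure (x * x') (tpure y z) : tensor S (tensor S S)).
Proof.
split=> [z a s t|s a z z'] /=.
- by rewrite mulrDr tpureDl -scalerAr tpureZl.
- by rewrite !(tpureDr, tpureZr).
Qed.

Let dist_out v : bilinear_for *:%R *:%R (fun x y : S =>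
  tlift (fun x' z => tpure (x * x') (tpure y z)) v : tensor S (tensor S S)).
Proof.
split=> [y|x] /=; apply: tlift_param => // m n a s t.
- by rewrite mulrDl tpureDl -scalerAl tpureZl.
- by rewrite tpureDl tpureDr tpureZl tpureZr.
Qed.

Let distE x y x' z :
  dist (tpure x y) (tpure x' z) = tpure (x * x') (tpure y z).
Proof. by rewrite /dist (tliftE (dist_out _)) (tliftE (dist_in _ _)). Qed.

Let dist_bilin : bilinear_for *:%R *:%R dist.
Proof.
split=> [v|u]; first exact: (tlift_linear (dist_out v)).
by apply: tlift_param => [v|m n]; [exact: dist_out | exact: tlift_linear (dist_in m n)].
Qed.

Let dist_mul u v u' v' : dist (u * u') (v * v') = dist u v * dist u' v'.
Proof.
have dDl w : {morph dist^~ w : x y / x + y} by apply: addlin (dist_bilin.1 w).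
have dDr w : {morph dist w : x y / x + y} by apply: addlin (dist_bilin.2 w).
have d0l w : dist 0 w = 0 by apply: (addrI (dist 0 w)); rewrite -dDl !addr0.
have d0r w : dist w 0 = 0 by apply: (addrI (dist w 0)); rewrite -dDr !addr0.
elim/tensor_ind: u => [|x y|u1 u2 IH1 IH2]; first by rewrite mul0r !d0l mul0r.
  elim/tensor_ind: u' => [|x' y'|u1 u2 IH1 IH2]; first by rewrite mulr0 !d0l mulr0.
    elim/tensor_ind: v => [|z t|v1 v2 IH1 IH2]; first by rewrite mul0r !d0r mul0r.
      elim/tensor_ind: v' => [|z' t'|v1 v2 IH1 IH2].
      + by rewrite mulr0 !d0r mulr0.
      + by rewrite !tpureM !distE !tpureM mulrACA.
      + by rewrite mulrDr !dDr IH1 IH2 mulrDr.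
    by rewrite mulrDl !dDr IH1 IH2 mulrDl.
  by rewrite mulrDr !dDl IH1 IH2 mulrDr.
by rewrite mulrDl !dDl IH1 IH2 mulrDl.
Qed.

Fact poly_comulDr s :
  tmap idfun poly_coadd (poly_comul s)
  = tlift (fun u v : tensor S S =>
             tlift (fun x y => tlift (fun x' z =>
               tpure (x * x') (tpure y z)) v) u)
          (tmap poly_comul poly_comul (poly_coadd s)).
Proof.
move: s; apply: (@ext (tensor S (tensor S S)) *%R).
- exact: (mul_linear_comp (mul_linear_tmap idfun poly_coadd) (hom_lr poly_comul)).
- apply: mul_linear_comp; last first.
    exact: (mul_linear_comp (mul_linear_tmap poly_comul poly_comul) (hom_lr poly_coadd)).
  apply: mul_linear_tlift; [exact: tensor_mul_bilin | exact: dist_bilin |].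
  by move=> u v u' v'; apply: dist_mul.
- rewrite !rmorph1 !tensor1E.
  rewrite (tmapE idfun poly_coadd) (tmapE poly_comul poly_comul) !rmorph1.
  by rewrite (tliftE dist_bilin) !tensor1E distE mulr1.
- rewrite coaddX comulX (tmapE idfun poly_coadd).
  rewrite (addlin (tmap_linear poly_comul poly_comul)).
  rewrite !(tmapE poly_comul poly_comul) /= !rmorph1 comulX (tliftD dist_bilin).
  rewrite !(tliftE dist_bilin) !tensor1E.
  by rewrite !distE mulr1 mul1r /= coaddX tpureDr.
Qed.

Definition poly_biring : biring A S :=
  Biring poly_coaddA poly_coaddC poly_coadd0 poly_coaddN
         poly_comulA poly_comulC poly_comul1 poly_comulDr
         poly_colinD poly_colinM.

End PolyBiring.

Section IntegerValued.
Variable D : idomainType.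
Local Notation K := {fraction D}.
Local Notation "x %:F" := (@FracField.tofrac D x).

Definition int_valued : {pred {poly K}} :=
  fun f => `[< forall a : D, exists b : D, f.[a%:F] = b%:F >].

Lemma int_valuedP f :
  reflect (forall a : D, exists b : D, f.[a%:F] = b%:F) (f \in int_valued).
Proof. exact: asboolP. Qed.

Fact int_valued_subring : subring_closed int_valued.
Proof.
split=> [|f g /int_valuedP fD /int_valuedP gD|f g /int_valuedP fD /int_valuedP gD];
    apply/int_valuedP => a.
- by exists 1; rewrite hornerC rmorph1.
- have [[b fb] [c gc]] := (fD a, gD a).
  by exists (b - c); rewrite hornerD hornerN fb gc rmorphB.
- have [[b fb] [c gc]] := (fD a, gD a).
  by exists (b * c); rewrite hornerM fb gc rmorphM.
Qed.

HB.instance Definition _ :=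
  GRing.isSubringClosed.Build {poly K} int_valued int_valued_subring.

Record intPoly := IntPoly {
  int_poly_val :> {poly K};
  int_poly_valP : int_poly_val \in int_valued
}.

HB.instance Definition _ := [isSub for int_poly_val].
HB.instance Definition _ := [Choice of intPoly by <:].
HB.instance Definition _ := [SubChoice_isSubComNzRing of intPoly by <:].

Fact int_valued_map (p : {poly D}) : map_poly (@FracField.tofrac D) p \in int_valued.
Proof. by apply/int_valuedP => a; exists p.[a]; rewrite horner_map. Qed.

Fact int_valuedZ (a : D) (f : intPoly) : a%:F *: (f : {poly K}) \in int_valued.
Proof.
apply/int_valuedP => c; have /int_valuedP/(_ c)[b fb] := int_poly_valP f.
by exists (a * b); rewrite hornerZ fb rmorphM.
Qed.

Definition int_scale (a : D) (f : intPoly) : intPoly := IntPoly (int_valuedZ a f).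

Fact int_scaleA a b f : int_scale a (int_scale b f) = int_scale (a * b) f.
Proof. by apply: val_inj; rewrite /= scalerA rmorphM. Qed.

Fact int_scale1 : left_id 1 int_scale.
Proof. by move=> f; apply: val_inj; rewrite /= rmorph1 scale1r. Qed.

Fact int_scaleDr : right_distributive int_scale +%R.
Proof. by move=> a f g; apply: val_inj; rewrite /= scalerDr. Qed.

Fact int_scaleDl f : {morph int_scale^~ f : a b / a + b}.
Proof. by move=> a b; apply: val_inj; rewrite /= rmorphD scalerDl. Qed.

HB.instance Definition _ := GRing.Zmodule_isLmodule.Build D intPoly
  int_scaleA int_scale1 int_scaleDr int_scaleDl.

Fact int_scaleAl (a : D) (f g : intPoly) : a *: (f * g) = a *: f * g.
Proof. by apply: val_inj; rewrite /= scalerAl. Qed.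

HB.instance Definition _ := GRing.Lmodule_isLalgebra.Build D intPoly int_scaleAl.
HB.instance Definition _ := GRing.Lalgebra_isComAlgebra.Build D intPoly.

Definition int_incl (p : {poly D}) : intPoly := IntPoly (int_valued_map p).

Fact int_incl_linear : linear int_incl.
Proof.
move=> a p q; apply: val_inj => /=.
by rewrite rmorphD /= map_polyZ.
Qed.

Fact int_incl_monoid : monoid_morphism int_incl.
Proof.
split=> [|p q]; apply: val_inj => /=; first by rewrite rmorph1.
by rewrite rmorphM.
Qed.

HB.instance Definition _ :=
  GRing.isLinear.Build D {poly D} intPoly *:%R int_incl int_incl_linear.
HB.instance Definition _ :=
  GRing.isMonoidMorphism.Build {poly D} intPoly int_incl int_incl_monoid.

Definition compatible (B : biring D intPoly) : Prop :=
  biring_hom (poly_biring D) B int_incl.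

(* As in polyXY, {poly {poly K}} has main variable 'X and coefficient variable
   'Y, so that g^:P is g('X) and h%:P is h('Y). *)
Definition sum_of_products (F : {poly {poly K}}) : Prop :=
  exists s : seq (intPoly * intPoly),
    F = \sum_(gh <- s) (gh.1 : {poly K})^:P * (gh.2 : {poly K})%:P.

End IntegerValued.

(* Main.v *)
(* Every f in Int(D) has a nonzero D-multiple in D[X], so two D-linear maps from
   Int(D) to a torsion-free module agree as soon as they agree on D[X].  This
   gives uniqueness, and it reduces each biring law on Int(D) to the same law on
   D[X].  By the same denominators, torsion-freeness of Int(D) (x) Int(D) makes
   g (x) h |-> g(X)h(Y) an injection into K[X, Y]; the condition on f(X + Y) and
   f(XY) says that these lift along it, and the lifts are the
   co-operations. *)
Require Import Defs.
From HB Require Import structures.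
From mathcomp Require Import all_boot all_algebra.
From mathcomp Require Import boolp.
Set Implicit Arguments.
Unset Strict Implicit.
Unset Printing Implicit Defensive.
Import GRing.Theory.
Local Open Scope ring_scope.

(** * Linear maps out of tensor products and naturality of the structural maps *)

Section LinearTensor.
Variable A : comNzRingType.
Implicit Types M N P Q : lmodType A.

Lemma linear_add M N (h : M -> N) : linear h -> {morph h : x y / x + y}.
Proof. by move=> hl x y; have := hl 1 x y; rewrite !scale1r. Qed.

Lemma linear_zero M N (h : M -> N) : linear h -> h 0 = 0.
Proof.
by move=> hl; apply: (addrI (h 0)); rewrite -(linear_add hl) !addr0.
Qed.

Lemma linear_scale M N (h : M -> N) a : linear h -> {morph h : x / a *: x}.
Proof. by move=> hl x; have := hl a x 0; rewrite (linear_zero hl) !addr0. Qed.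

Lemma linear_comp M N P (g : N -> P) (h : M -> N) :
  linear g -> linear h -> linear (fun x => g (h x)).
Proof. by move=> gl hl a x y; rewrite hl gl. Qed.

Lemma tpure_linearl M N (n : N) : linear (fun m : M => tpure m n).
Proof. by move=> a m m'; rewrite tpureDl tpureZl. Qed.

Lemma tpure_linearr M N (m : M) : linear (fun n : N => tpure m n).
Proof. by move=> a n n'; rewrite tpureDr tpureZr. Qed.

Lemma tensor_ext M N P (h k : tensor M N -> P) :
  linear h -> linear k -> (forall m n, h (tpure m n) = k (tpure m n)) -> h =1 k.
Proof.
move=> hl kl hk; elim/tensor_ind=> [|m n|x y IHx IHy] //.
  by rewrite !linear_zero.
by rewrite (linear_add hl) (linear_add kl) IHx IHy.
Qed.

Lemma eq_tlift M N P (b c : M -> N -> P) x :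
  (forall m n, b m n = c m n) -> tlift b x = tlift c x.
Proof. by move=> bc; apply: eq_bigr => p _; apply: bc. Qed.

(** [tlift b x] is by definition a finite sum over a representative of [x], and an additive map
    passes through such a sum. *)
Lemma tlift_comp M N P Q (h : P -> Q) (b : M -> N -> P) x :
  linear h -> h (tlift b x) = tlift (fun m n => h (b m n)) x.
Proof. by move=> hl; apply: (big_morph h (linear_add hl) (linear_zero hl)). Qed.

Lemma tlift_tmap M N P Q (R : lmodType A) (b : P -> Q -> R)
    (f : M -> P) (g : N -> Q) x :
  bilinear_for *:%R *:%R b ->
  tlift b (tmap f g x) = tlift (fun m n => b (f m) (g n)) x.
Proof.
move=> b_bilin; rewrite [LHS]tlift_comp; last exact: tlift_linear.
by apply: eq_tlift => m n; rewrite tliftE.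
Qed.

(** Linearity is asked of the outer pair, whose [tmap] has to be evaluated on pure tensors; the
    inner pair enters only through the sum over a representative. *)
Lemma tmap_comp M N P Q (M' N' : lmodType A)
    (f : {linear P -> M'}) (g : {linear Q -> N'})
    (f' : M -> P) (g' : N -> Q) x :
  tmap f g (tmap f' g' x) = tmap (fun m => f (f' m)) (fun n => g (g' n)) x.
Proof. by rewrite [LHS]tlift_tmap //; apply: tpure_bilin. Qed.

Lemma eq_tmap M N P Q (f f' : M -> P) (g g' : N -> Q) x :
  f =1 f' -> g =1 g' -> tmap f g x = tmap f' g' x.
Proof. by move=> ff gg; apply: eq_tlift => m n; rewrite ff gg. Qed.

HB.instance Definition _ M N P Q (f : {linear M -> P}) (g : {linear N -> Q}) :=
  GRing.isLinear.Build A (tensor M N) (tensor P Q) *:%R (tmap f g)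
    (tmap_linear f g).

Lemma tassoc_tmap M N P (M' N' P' : lmodType A)
    (f : {linear M -> M'}) (g : {linear N -> N'}) (h : {linear P -> P'}) x :
  tassoc (tmap (tmap f g) h x) = tmap f (tmap g h) (tassoc x).
Proof.
have tassocl M1 N1 P1 : linear (@tassoc A M1 N1 P1).
  exact/tlift_linear/tassoc_bilin.
move: x; apply: tensor_ext => [||u p].
- exact: linear_comp (tassocl _ _ _) (tmap_linear (tmap f g) h).
- exact: linear_comp (tmap_linear f (tmap g h)) (tassocl _ _ _).
(* The left factor [u] is itself a tensor, so extensionality is applied a second time. *)
move: u; apply: tensor_ext => [||m n].
- apply: linear_comp (tassocl _ _ _) _.
  apply: linear_comp (tmap_linear (tmap f g) h) _; exact: tpure_linearl.
- apply: linear_comp (tmap_linear f (tmap g h)) _.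
  apply: linear_comp (tassocl _ _ _) _; exact: tpure_linearl.
by rewrite (tmapE (tmap f g) h) /= tmapE !tassocE (tmapE f (tmap g h)) /= tmapE.
Qed.

Lemma tswap_tmap M N P Q (f : {linear M -> P}) (g : {linear N -> Q}) x :
  tswap (tmap f g x) = tmap g f (tswap x).
Proof.
have tswapl M1 N1 : linear (@tswap A M1 N1) by apply/tlift_linear/tswap_bilin.
move: x; apply: tensor_ext => [||m n].
- exact: linear_comp (tswapl _ _) (tmap_linear _ _).
- exact: linear_comp (tmap_linear _ _) (tswapl _ _).
by rewrite !(tmapE, tswapE).
Qed.

End LinearTensor.

(** * The map dual to expanding x (y + z) as x y + x z *)

Section Distributor.
Variable A : comNzRingType.

(** The bilinear map in the axiom [comulDr]. The factor x occurs twice in x y + x z, so dually its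
    two copies are multiplied together. *)
Definition distr_tensor (S : comAlgType A) (u v : tensor S S) :
    tensor S (tensor S S) :=
  tlift (fun x y => tlift (fun x' z => tpure (x * x') (tpure y z)) v) u.

Lemma distr_inner_bilin (S : comAlgType A) (x y : S) :
  bilinear_for *:%R *:%R (fun x' z : S => tpure (x * x') (tpure y z)).
Proof.
split=> [z a s t|s a z z'] /=.
- by rewrite mulrDr tpureDl -scalerAr tpureZl.
- by rewrite !(tpureDr, tpureZr).
Qed.

Lemma distr_outer_bilin (S : comAlgType A) (v : tensor S S) :
  bilinear_for *:%R *:%R
    (fun x y : S => tlift (fun x' z => tpure (x * x') (tpure y z)) v).
Proof.
split=> [y|x]; (apply: tlift_param => [q|m n a s t];
  first exact: distr_inner_bilin).
- by rewrite mulrDl tpureDl -scalerAl tpureZl.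
- by rewrite tpureDl tpureDr tpureZl tpureZr.
Qed.

Lemma distr_tensor_bilin (S : comAlgType A) :
  bilinear_for *:%R *:%R (@distr_tensor S).
Proof.
split=> [v|u]; first exact: (tlift_linear (distr_outer_bilin v)).
apply: tlift_param => [v|m n]; first exact: distr_outer_bilin.
exact/tlift_linear/distr_inner_bilin.
Qed.

(** Naturality in the algebra: merging the two copies commutes with [phi] because [phi] is
    multiplicative. *)
Lemma distr_tensor_tmap (S T : comAlgType A) (phi : {lrmorphism S -> T}) u v :
  distr_tensor (tmap phi phi u) (tmap phi phi v)
  = tmap phi (tmap phi phi) (distr_tensor u v).
Proof.
rewrite /distr_tensor tlift_tmap; last exact: distr_outer_bilin.
rewrite [RHS]tlift_comp; last exact: (tmap_linear phi (tmap phi phi)).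
apply: eq_tlift => x y.
rewrite tlift_tmap; last exact: distr_inner_bilin.
rewrite [RHS]tlift_comp; last exact: (tmap_linear phi (tmap phi phi)).
apply: eq_tlift => x' z.
by rewrite (tmapE phi (tmap phi phi)) /= (tmapE phi phi) rmorphM.
Qed.

End Distributor.

(** * Torsion-free tensor products *)

Section TorsionFree.
Variable A : comNzRingType.

Lemma torsion_free_inj (M N : lmodType A) (h : M -> N) :
  linear h -> injective h -> torsion_free N -> torsion_free M.
Proof.
move=> hl h_inj tfN a m a0 am0; apply: h_inj; rewrite (linear_zero hl).
by apply: (tfN a) => //; rewrite -(linear_scale a hl) am0 linear_zero.
Qed.

(** Multiplication by [a] is injective on [N]; flatness of [M] keeps it injective after tensoring,
    where it is again multiplication by [a]. *)
Lemma flat_tensor_torsion_free (M N : lmodType A) :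
  flat M -> torsion_free N -> torsion_free (tensor M N).
Proof.
move=> flM tfN a x a0 ax0.
pose f : {linear N -> N} := GRing.scale a.
have f_inj : injective f.
  move=> m n /eqP; rewrite -subr_eq0 -linearB => /eqP mn.
  by apply/eqP; rewrite -subr_eq0; apply/eqP/(tfN a).
apply: (flM _ _ f f_inj); rewrite linear0 -[RHS]ax0.
move: x {ax0}; apply: tensor_ext => [||m n].
- exact: (tmap_linear idfun f).
- by move=> b y z; rewrite scalerDr !scalerA mulrC.
- by rewrite (tmapE idfun f) /= tpureZr.
Qed.

(** [tpow] ends with a factor [A^o]; this map and its left inverse serve to discard that factor. *)
Definition tunit (M : lmodType A) (m : M) : tensor M A^o := tpure m 1.

Definition tunit_inv (M : lmodType A) : tensor M A^o -> M :=
  tlift (fun (m : M) (a : A^o) => a *: m).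

Lemma tunit_linear (M : lmodType A) : linear (@tunit M).
Proof. exact: tpure_linearl. Qed.

Lemma tunit_bilin (M : lmodType A) :
  bilinear_for *:%R *:%R (fun (m : M) (a : A^o) => a *: m).
Proof.
split=> [b a m n|m a b c] /=; first by rewrite scalerDr !scalerA mulrC.
by rewrite scalerDl scalerA.
Qed.

Lemma tunit_inv_linear (M : lmodType A) : linear (@tunit_inv M).
Proof. exact/tlift_linear/tunit_bilin. Qed.

Lemma tunitK (M : lmodType A) : cancel (@tunit M) (@tunit_inv M).
Proof.
by move=> m; rewrite /tunit_inv tliftE ?scale1r //; exact: tunit_bilin.
Qed.

HB.instance Definition _ M :=
  GRing.isLinear.Build A M (tensor M A^o) *:%R
    (@tunit M) (@tunit_linear M).
HB.instance Definition _ M :=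
  GRing.isLinear.Build A (tensor M A^o) M *:%R
    (@tunit_inv M) (@tunit_inv_linear M).

(** Tensoring need not preserve injectivity, but it preserves left inverses, so the insertion of a
    trailing [A^o] stays injective under further tensor factors. *)
Lemma tmap_cancel (L M N : lmodType A)
    (f : {linear M -> N}) (g : {linear N -> M}) :
  cancel f g -> cancel (tmap (@idfun L) f) (tmap (@idfun L) g).
Proof.
move=> fK x; rewrite (tmap_comp idfun g).
rewrite (eq_tmap (f' := idfun) (g' := idfun)) //.
move: x; apply: tensor_ext => [|//|l m]; first exact: tmap_linear idfun idfun.
exact: tmapE idfun idfun l m.
Qed.

End TorsionFree.

(** * Maps with torsion cokernel *)

Section TorsionCokernel.
Variables (A : comNzRingType) (S T : lmodType A) (phi : S -> T).
Hypothesis phi_tors : forall t, exists a s, a != 0 /\ a *: t = phi s.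

(** If [a *: t = phi s], then [a] times [h t - k t] is the difference of [h] and [k] at [phi s],
    which vanishes; [a] can then be cancelled in [M]. *)
Lemma torsion_coker_ext (M : lmodType A) (h k : T -> M) :
  torsion_free M -> linear h -> linear k ->
  (forall s, h (phi s) = k (phi s)) -> h =1 k.
Proof.
move=> tfM hl kl hk t; have [a [s [a0 ats]]] := phi_tors t.
apply/eqP; rewrite -subr_eq0; apply/eqP/(tfM a) => //.
by rewrite scalerBr -(linear_scale a hl) -(linear_scale a kl) ats hk subrr.
Qed.

End TorsionCokernel.

(** * Transfer of a biring structure along a map with torsion cokernel *)

Section BiringTransfer.
Variables (A B : comNzRingType) (S T : comAlgType A) (BS : biring B S).
Variable phi : {lrmorphism S -> T}.
Hypothesis phi_tors : forall t, exists a s, a != 0 /\ a *: t = phi s.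
Hypothesis tfA : torsion_free (A^o : lmodType A).
Hypothesis tfT1 : torsion_free T.
Hypothesis tfT2 : torsion_free (tensor T T).
Hypothesis tfT3 : torsion_free (tensor T (tensor T T)).

Lemma biring_hom_unique (B1 B2 : biring B T) :
  biring_hom BS B1 phi -> biring_hom BS B2 phi -> same_biring B1 B2.
Proof.
move=> [a1 m1 c1] [a2 m2 c2]; split=> [||b].
- apply: (torsion_coker_ext phi_tors tfT2 (linearP _) (linearP _)) => s.
  exact: etrans (esym (a1 s)) (a2 s).
- apply: (torsion_coker_ext phi_tors tfT2 (linearP _) (linearP _)) => s.
  exact: etrans (esym (m1 s)) (m2 s).
- apply: (torsion_coker_ext phi_tors tfA (linearP _) (linearP _)) => s.
  exact: etrans (c1 b s) (esym (c2 b s)).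
Qed.

Variables (ca cm : {lrmorphism T -> tensor T T}).
Variable be : B -> {lrmorphism T -> A | *%R}.
Variable sigma : {lrmorphism T -> T}.
Hypothesis caE : forall s, tmap phi phi (coadd BS s) = ca (phi s).
Hypothesis cmE : forall s, tmap phi phi (comul BS s) = cm (phi s).
Hypothesis beE : forall b s, be b (phi s) = colin BS b s.
(** A biring only asserts that some antipode exists, so [sigma] is not compared with one on [S]: its
    law is assumed directly on the image of [phi]. *)
Hypothesis sigmaE : forall s,
  tlift (fun t1 t2 : T => sigma t1 * t2) (ca (phi s)) = (be 0 (phi s))%:A.

(** Stated for an arbitrary pair of maps, so that it serves both co-addition and co-multiplication;
    on the image of [phi] it is the law of [fS] pushed forward by naturality of [tassoc]. *)
Let coassoc (fS : {lrmorphism S -> tensor S S})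
    (f : {lrmorphism T -> tensor T T}) :
    (forall s, tmap phi phi (fS s) = f (phi s)) ->
    (forall s, tassoc (tmap fS idfun (fS s)) = tmap idfun fS (fS s)) ->
  forall t, tassoc (tmap f idfun (f t)) = tmap idfun f (f t).
Proof.
move=> fE fSA; apply: (torsion_coker_ext phi_tors) => [|||s].
- exact: tfT3.
- apply: linear_comp; first exact/tlift_linear/tassoc_bilin.
  exact: linear_comp (tmap_linear f idfun) (linearP f).
- exact: linear_comp (tmap_linear idfun f) (linearP f).
rewrite -fE (tmap_comp f idfun) (tmap_comp idfun f).
(* Moves [phi] past [f] on the first factor, so that [phi] can be factored out of all three tensor
   places. *)
rewrite (eq_tmap (f' := fun s => tmap phi phi (fS s)) (g' := phi)) //.
rewrite -(tmap_comp (tmap phi phi) phi fS idfun) (tassoc_tmap phi phi phi) fSA.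
rewrite (tmap_comp phi (tmap phi phi) idfun fS).
by apply: eq_tmap => // s'; rewrite fE.
Qed.

Let cocomm (fS : {lrmorphism S -> tensor S S})
    (f : {lrmorphism T -> tensor T T}) :
    (forall s, tmap phi phi (fS s) = f (phi s)) ->
    (forall s, tswap (fS s) = fS s) ->
  forall t, tswap (f t) = f t.
Proof.
move=> fE fSC; apply: (torsion_coker_ext phi_tors) => [|||s].
- exact: tfT2.
- apply: linear_comp (linearP f); exact/tlift_linear/tswap_bilin.
- exact: linearP.
by rewrite -fE (tswap_tmap phi phi) fSC.
Qed.

Let counit_bilin b :
  bilinear_for *:%R *:%R (fun t1 t2 : T => be b t1 *: t2).
Proof.
split=> [t a x y|t a x y] /=.
- by rewrite linearP scalerDl scalerA.
- by rewrite scalerDr !scalerA mulrC.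
Qed.

Let counit b (fS : {lrmorphism S -> tensor S S})
    (f : {lrmorphism T -> tensor T T}) :
    (forall s, tmap phi phi (fS s) = f (phi s)) ->
    (forall s, tlift (fun s1 s2 : S => colin BS b s1 *: s2) (fS s) = s) ->
  forall t, tlift (fun t1 t2 : T => be b t1 *: t2) (f t) = t.
Proof.
move=> fE fSu; apply: (torsion_coker_ext phi_tors) => [|||s] //.
- exact: linear_comp (tlift_linear (counit_bilin b)) (linearP f).
rewrite -fE (tlift_tmap _ _ _ (counit_bilin b)) -[in RHS](fSu s).
rewrite [RHS]tlift_comp; last exact: linearP.
by apply: eq_tlift => x y; rewrite beE linearZ.
Qed.

Let pair_bilin b c :
  bilinear_for *:%R *:%R (fun t1 t2 : T => be b t1 * be c t2 : A^o).
Proof.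
split=> [t a x y|t a x y] /=; rewrite linearP.
- by rewrite mulrDl -mulrA.
- by rewrite mulrDr mulrCA.
Qed.

(** Here [d] stands for [b + c] when [fS] is co-addition and for [b * c] when it is
    co-multiplication. *)
Let colin_op b c d (fS : {lrmorphism S -> tensor S S})
    (f : {lrmorphism T -> tensor T T}) :
    (forall s, tmap phi phi (fS s) = f (phi s)) ->
    (forall s, colin BS d s
       = tlift (fun s1 s2 : S => colin BS b s1 * colin BS c s2 : A^o) (fS s)) ->
  forall t, be d t = tlift (fun t1 t2 : T => be b t1 * be c t2 : A^o) (f t).
Proof.
move=> fE fSo; apply: (torsion_coker_ext phi_tors (M := A^o)) => [|||s].
- exact: tfA.
- by move=> a x y; rewrite linearP.
- exact: linear_comp (tlift_linear (pair_bilin b c)) (linearP f).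
rewrite -fE (tlift_tmap _ _ _ (pair_bilin b c)) beE fSo.
by apply: eq_tlift => x y; rewrite !beE.
Qed.

Let comulDr_transfer t :
  tmap idfun ca (cm t)
  = tlift (@distr_tensor A T) (tmap cm cm (ca t)).
Proof.
move: t; apply: (torsion_coker_ext phi_tors) => [|||s].
- exact: tfT3.
- exact: linear_comp (tmap_linear idfun ca) (linearP cm).
- apply: linear_comp; first exact: tlift_linear (distr_tensor_bilin T).
  exact: linear_comp (tmap_linear cm cm) (linearP ca).
rewrite -caE -cmE (tmap_comp idfun ca) (tmap_comp cm cm).
(* Both sides are images under the triple tensor power of [phi] of the two sides of [comulDr] for
   [BS]. *)
transitivity (tmap phi (tmap phi phi) (tmap idfun (coadd BS) (comul BS s))).
  rewrite (tmap_comp phi (tmap phi phi)).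
  by apply: eq_tmap => // s'; apply/esym/caE.
rewrite comulDr -[tlift _ _]/(tlift (@distr_tensor A S) _).
rewrite (tlift_tmap _ _ _ (distr_tensor_bilin S)).
rewrite tlift_comp; last exact: (tmap_linear phi (tmap phi phi)).
rewrite (tlift_tmap _ _ _ (distr_tensor_bilin T)).
by apply: eq_tlift => x y; rewrite -distr_tensor_tmap !cmE.
Qed.

Let coaddN_transfer t :
  tlift (fun t1 t2 : T => sigma t1 * t2) (ca t) = (be 0 t)%:A.
Proof.
move: t; apply: (torsion_coker_ext phi_tors) => [|||s].
- exact: tfT1.
- apply: linear_comp (linearP ca); apply: tlift_linear.
  split=> [t a x y|t a x y] /=.
    by rewrite linearP mulrDl scalerAl.
  by rewrite mulrDr scalerAr.
- by move=> a x y; rewrite linearP scalerDl scalerA.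
- exact: sigmaE.
Qed.

Definition transfer_biring : biring B T :=
  Biring (coassoc caE (@coaddA _ _ _ BS)) (cocomm caE (@coaddC _ _ _ BS))
    (counit caE (@coadd0 _ _ _ BS)) (ex_intro _ sigma coaddN_transfer)
    (coassoc cmE (@comulA _ _ _ BS)) (cocomm cmE (@comulC _ _ _ BS))
    (counit cmE (@comul1 _ _ _ BS)) comulDr_transfer
    (fun b c => colin_op caE (@colinD _ _ _ BS b c))
    (fun b c => colin_op cmE (@colinM _ _ _ BS b c)).

Lemma transfer_biring_hom : biring_hom BS transfer_biring phi.
Proof. by []. Qed.

End BiringTransfer.

(** * Polynomials in two variables as elements of A[X] (x) A[X] *)

Section PolyTensor.
Variable A : comNzRingType.

(** The substitution of X (x) 1 for the main variable and 1 (x) X for the coefficient variable. By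
    [poly_tensorE] it undoes p (x) q |-> p(X)q(Y). *)
Definition poly_tensor (F : {poly {poly A}}) : tensor {poly A} {poly A} :=
  (map_poly (poly_ev (tpure 1 'X : tensor {poly A} {poly A})) F).[tpure 'X 1].

Lemma poly_tensorE (p q : {poly A}) :
  poly_tensor (p^:P * q%:P) = tpure p q.
Proof.
pose L := tensor {poly A} {poly A}.
(* Both maps are linear and multiplicative, with equal values at 1 and at X. *)
have jE r : poly_ev (tpure 1 'X : L) r = tpure 1 r.
  move: r; apply: (@poly_hom_ext A L *%R); rewrite ?poly_evX ?rmorph1 //.
  - exact: linearP.
  - exact: tpure_linearr.
  - exact: rmorphM.
  - by move=> r s; rewrite tpureM mulr1.
rewrite /poly_tensor rmorphM hornerM /= map_polyC hornerC /= jE.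
suff -> : (map_poly (poly_ev (tpure 1 'X : L)) p^:P).[tpure 'X 1] = tpure p 1.
  by rewrite tpureM mulr1 mul1r.
elim/poly_ind: p => [|p c IHp].
  by rewrite !rmorph0 horner0 (linear_zero (tpure_linearl _)).
rewrite !(rmorphD, rmorphM) /= !map_polyX !map_polyC /=.
rewrite hornerD hornerM hornerX hornerC IHp.
rewrite tpureM mulr1 tpureDl /= jE; congr (_ + _).
(* A constant crosses the tensor sign: 1 (x) c = c (x) 1. *)
by rewrite -[c%:P]alg_polyC tpureZr tpureZl.
Qed.

Lemma poly_tensorD : {morph poly_tensor : F G / F + G}.
Proof. by move=> F G; rewrite /poly_tensor rmorphD hornerD. Qed.

Lemma poly_tensor0 : poly_tensor 0 = 0.
Proof. by rewrite /poly_tensor rmorph0 horner0. Qed.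

End PolyTensor.

(** * Denominators, and evaluation of Int(D) (x) Int(D) in K[X, Y] *)

Section IntPolyTensor.
Variable D : idomainType.
Local Notation K := {fraction D}.
Local Notation I := (intPoly D).
Local Notation "x %:F" := (@FracField.tofrac D x).
Local Notation incl := (@int_incl D).

(* A copy of K[Y][X], whose own scalars are K[Y], as a D-module. *)
Definition bipoly : Type := {poly {poly K}}.
HB.instance Definition _ := GRing.ComNzRing.copy bipoly {poly {poly K}}.

Definition bipoly_scale (a : D) (F : bipoly) : bipoly := a%:F%:P%:P * F.

Fact bipoly_scaleA a b F :
  bipoly_scale a (bipoly_scale b F) = bipoly_scale (a * b) F.
Proof. by rewrite /bipoly_scale tofracM !polyCM mulrA. Qed.

Fact bipoly_scale1 : left_id 1 bipoly_scale.
Proof. by move=> F; rewrite /bipoly_scale tofrac1 !polyC1 mul1r. Qed.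

Fact bipoly_scaleDr : right_distributive bipoly_scale +%R.
Proof. by move=> a F G; rewrite /bipoly_scale mulrDr. Qed.

Fact bipoly_scaleDl F : {morph bipoly_scale^~ F : a b / a + b}.
Proof. by move=> a b; rewrite /bipoly_scale tofracD !polyCD mulrDl. Qed.

HB.instance Definition _ := GRing.Zmodule_isLmodule.Build D bipoly
  bipoly_scaleA bipoly_scale1 bipoly_scaleDr bipoly_scaleDl.

Lemma bipoly_scaleE (a : D) (F : bipoly) : a *: F = a%:F%:P%:P * F.
Proof. by []. Qed.

Lemma tofrac_inj : injective (@FracField.tofrac D).
Proof. by move=> a b /eqP; rewrite tofrac_eq => /eqP. Qed.

Lemma bipoly_torsion_free : torsion_free bipoly.
Proof.
move=> a F a0 /eqP; rewrite bipoly_scaleE mulf_eq0 !polyC_eq0 tofrac_eq0.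
by rewrite (negPf a0) => /eqP.
Qed.

Lemma intPoly_torsion_free : torsion_free I.
Proof.
move=> a f a0 /(congr1 val) /= /eqP; rewrite scaler_eq0 tofrac_eq0 (negPf a0).
by move=> /eqP f0; apply: val_inj.
Qed.

Lemma idomain_torsion_free : torsion_free (D^o : lmodType D).
Proof.
move=> a b a0 ab0; apply/eqP; have /eqP : a * b = 0 by exact: ab0.
by rewrite mulf_eq0 (negPf a0).
Qed.

Lemma fraction_denom (x : K) : exists a b : D, a != 0 /\ a%:F * x = b%:F.
Proof.
elim/quotW: x => x; exists \d_x, \n_x; split; first exact: denom_ratioP.
(* Unfolds the product in the fraction field, leaving a cross-multiplication identity between
   ratios. *)
rewrite -[_ * _]/(FracField.mul _ _) !piE.
apply/eqmodP; rewrite /= FracField.equivfE /FracField.mulf.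
rewrite !numden_Ratio ?(oner_eq0, mulf_neq0, denom_ratioP) //.
by rewrite !mul1r mulr1 mulrC.
Qed.

Lemma poly_denom (f : {poly K}) :
  exists (a : D) (p : {poly D}),
    a != 0 /\ a%:F *: f = map_poly (@FracField.tofrac D) p.
Proof.
elim/poly_ind: f => [|f c [a [p [a0 fp]]]].
  by exists 1, 0; rewrite oner_eq0 scaler0 rmorph0.
have [b [d [b0 cd]]] := fraction_denom c.
(* [a] clears the denominators of [f] and [b] that of [c], so their product clears both. *)
exists (a * b), (b *: p * 'X + (a * d)%:P); split; first by rewrite mulf_neq0.
rewrite !tofracM rmorphD /= [map_poly _ (_ * 'X)]rmorphM /=.
rewrite map_polyZ map_polyX map_polyC -fp /= tofracM -cd.
rewrite scalerDr scalerAl scalerA [b%:F * a%:F]mulrC; congr (_ + _).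
by rewrite -mul_polyC -polyCM mulrA.
Qed.

(** The inclusion of D[X] in Int(D) has torsion cokernel, which makes the transfer results
    applicable to it. *)
Lemma int_incl_torsion (f : I) : exists a p, a != 0 /\ a *: f = incl p.
Proof.
have [a [p [a0 fp]]] := poly_denom f.
by exists a, p; split=> //; apply: val_inj.
Qed.

Lemma int_mul_bilin :
  bilinear_for *:%R *:%R
    (fun f g : I => (f : {poly K})^:P * (g : {poly K})%:P : bipoly).
Proof.
split=> [g a f f'|f a g g'] /=.
- by rewrite bipoly_scaleE rmorphD /= map_polyZ /= mulrDl -mul_polyC mulrA.
- rewrite bipoly_scaleE rmorphD /= -mul_polyC rmorphM mulrDr; congr (_ + _).
  by rewrite mulrCA.
Qed.

Definition int_tensor_eval : tensor I I -> bipoly :=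
  tlift (fun f g : I => (f : {poly K})^:P * (g : {poly K})%:P : bipoly).

Lemma int_tensor_evalE (f g : I) :
  int_tensor_eval (tpure f g) = (f : {poly K})^:P * (g : {poly K})%:P.
Proof. exact: tliftE int_mul_bilin _ _. Qed.

Lemma int_tensor_eval_linear : linear int_tensor_eval.
Proof. exact: tlift_linear int_mul_bilin. Qed.

Lemma bipoly_mul_bilin : bilinear_for *:%R *:%R (fun F G : bipoly => F * G).
Proof.
split=> [G a F F'|F a G G'] /=.
- by rewrite mulrDl !bipoly_scaleE mulrA.
- by rewrite mulrDr !bipoly_scaleE mulrCA.
Qed.

Lemma int_tensor_evalM : {morph int_tensor_eval : x y / x * y}.
Proof.
apply: tlift_mul; [exact: bipoly_mul_bilin | exact: int_mul_bilin |].
by move=> s t s' t'; rewrite /= !rmorphM mulrACA.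
Qed.

Lemma int_tensor_eval1 : int_tensor_eval 1 = 1.
Proof. by rewrite tensor1E int_tensor_evalE /= !rmorph1 mulr1. Qed.

Lemma sum_of_productsP (F : bipoly) :
  sum_of_products F <-> exists x, int_tensor_eval x = F.
Proof.
(* [tlift] sums over [repr x], so this representative is literally the required family of
   products. *)
split=> [[s ->]|[x <-]]; last by exists (repr x).
exists (\sum_(p <- s) tpure p.1 p.2).
rewrite (big_morph _ (linear_add int_tensor_eval_linear)
  (linear_zero int_tensor_eval_linear)).
by apply: eq_bigr => p _; rewrite int_tensor_evalE.
Qed.

(* Up to a denominator x comes from D[X] (x) D[X], which embeds into K[X, Y]. *)
Lemma int_tensor_eval_inj :
  torsion_free (tensor I I) -> injective int_tensor_eval.
Proof.
move=> tfII; suff ker0 x : int_tensor_eval x = 0 -> x = 0.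
  move=> x y exy; apply/eqP; rewrite -subr_eq0; apply/eqP/ker0.
  rewrite -scaleN1r addrC int_tensor_eval_linear exy.
  by rewrite bipoly_scaleE !rmorphN !rmorph1 mulN1r addNr.
have [a [y [a0 axy]]] : exists a y, a != 0 /\ a *: x = tmap incl incl y.
  elim/tensor_ind: x => [|f g|x x' [a [y [a0 xy]]] [a' [y' [a'0 xy']]]].
  - by exists 1, 0; rewrite oner_eq0 scaler0 linear0.
  - have [a [p [a0 fp]]] := int_incl_torsion f.
    have [b [q [b0 gq]]] := int_incl_torsion g.
    exists (a * b), (tpure p q); rewrite mulf_neq0 //; split=> //.
    by rewrite (tmapE incl incl) /= -fp -gq tpureZl tpureZr scalerA.
  (* Common denominator of two fractions: each numerator is multiplied by the other denominator. *)
  exists (a * a'), (a' *: y + a *: y'); rewrite mulf_neq0 //; split=> //.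
  have tl := tmap_linear incl incl.
  rewrite (linear_add tl) !(linear_scale _ tl) -xy -xy'.
  by rewrite !scalerA scalerDr [a' * a]mulrC.
move=> ex0; apply: (tfII a) => //.
have: int_tensor_eval (a *: x) = 0.
  by rewrite (linear_scale _ int_tensor_eval_linear) ex0 scaler0.
(* [y] comes from a polynomial F over D in two variables, and its evaluation is F with coefficients
   mapped into K; hence a zero evaluation forces F = 0. *)
rewrite axy; have [F [-> ->]] : exists F, y = poly_tensor F /\
    int_tensor_eval (tmap incl incl y)
    = map_poly (map_poly (@FracField.tofrac D)) F.
  elim/tensor_ind: {axy} y => [|p q|y y' [F [-> eF]] [F' [-> eF']]].
  - exists 0; rewrite poly_tensor0 linear0 rmorph0.
    by rewrite (linear_zero int_tensor_eval_linear).
  - exists (p^:P * q%:P); rewrite poly_tensorE (tmapE incl incl); split=> //.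
    rewrite int_tensor_evalE rmorphM /= map_polyC /=; congr (_ * _).
    by rewrite -!map_poly_comp; apply: eq_map_poly => c /=; rewrite map_polyC.
  - exists (F + F'); rewrite poly_tensorD linearD rmorphD.
    by rewrite (linear_add int_tensor_eval_linear) eF eF'.
move=> F0; suff -> : F = 0 by rewrite poly_tensor0 linear0.
apply: (map_inj_poly (map_inj_poly tofrac_inj (rmorph0 _)) (rmorph0 _)).
by rewrite F0 rmorph0.
Qed.

End IntPolyTensor.

(** * Co-operations, counits and antipode on Int(D), and the equivalence *)

Section CompatibleBiring.
Variable D : idomainType.
Local Notation K := {fraction D}.
Local Notation I := (intPoly D).
Local Notation "x %:F" := (@FracField.tofrac D x).
Local Notation incl := (@int_incl D).

Lemma int_tensor_eval_add_gen :
  int_tensor_eval (tmap incl incl (tpure 'X 1 + tpure 1 'X))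
  = 'X + 'Y :> {poly {poly K}}.
Proof.
rewrite linearD /= !(tmapE incl incl) (linear_add (@int_tensor_eval_linear D)).
by rewrite !int_tensor_evalE /= !map_polyX !rmorph1 mulr1 mul1r.
Qed.

Lemma int_tensor_eval_mul_gen :
  int_tensor_eval (tmap incl incl (tpure 'X 'X)) = 'X * 'Y :> {poly {poly K}}.
Proof. by rewrite (tmapE incl incl) int_tensor_evalE /= !map_polyX. Qed.

Section Substitution.
Variables (z : {poly {poly K}}) (w : tensor {poly D} {poly D}).
Hypothesis wz : int_tensor_eval (tmap incl incl w) = z.

(** The polynomial f(z). With z equal to X + Y or XY, and [w] the image of X under the matching
    co-operation of D[X], one argument covers both cases. *)
Definition int_subst (f : I) : bipoly D := (f : {poly K})^:P \Po z.

Lemma int_subst_linear : linear int_subst.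
Proof.
move=> a f g; rewrite /int_subst /= rmorphD /= comp_polyD map_polyZ /=.
by rewrite comp_polyZ -mul_polyC.
Qed.

Lemma int_substM : {morph int_subst : f g / f * g}.
Proof. by move=> f g; rewrite /int_subst /= rmorphM comp_polyM. Qed.

Lemma int_subst1 : int_subst 1 = 1.
Proof. by rewrite /int_subst /= rmorph1; apply: comp_polyC. Qed.

(** Both sides are linear and multiplicative in [p], which leaves p = 1 and p = X; the latter is the
    hypothesis [wz]. *)
Lemma int_subst_incl p :
  int_tensor_eval (tmap incl incl (poly_ev w p)) = int_subst (incl p).
Proof.
have tl := @int_tensor_eval_linear D.
have ml := mul_linear_tmap incl incl.
move: p; apply: (@poly_hom_ext D (bipoly D) *%R).
- exact: linear_comp tl (linear_comp ml.1 (linearP _)).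
- exact: linear_comp int_subst_linear (linearP _).
- by move=> p q; rewrite rmorphM /= ml.2 int_tensor_evalM.
- by move=> p q; rewrite rmorphM int_substM.
- rewrite !rmorph1 int_subst1 tensor1E (tmapE incl incl) !rmorph1.
  exact: int_tensor_eval1.
- by rewrite poly_evX wz /int_subst /= !map_polyX comp_polyX.
Qed.

(** Necessity: the evaluation of [f g] and g(z) agree on D[X], hence on Int(D) since K[X, Y] is
    torsion-free, so the tensor [f g] displays g(z) as a sum of products. *)
Lemma int_subst_cooperation (f : {lrmorphism I -> tensor I I}) :
  (forall p, tmap incl incl (poly_ev w p) = f (incl p)) ->
  forall g, sum_of_products (int_subst g).
Proof.
move=> fE g; apply/sum_of_productsP; exists (f g); move: g.
apply: (torsion_coker_ext (@int_incl_torsion D) (@bipoly_torsion_free D)).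
- exact: linear_comp (@int_tensor_eval_linear D) (linearP f).
- exact: int_subst_linear.
- by move=> p; rewrite -fE int_subst_incl.
Qed.

(** Sufficiency: pick a tensor evaluating to g(z) for each [g]. Evaluation is injective, so the
    choice is forced and inherits linearity and multiplicativity from substitution. *)
Lemma int_cooperation : torsion_free (tensor I I) ->
    (forall g, sum_of_products (int_subst g)) ->
  exists f : {lrmorphism I -> tensor I I},
    forall p, tmap incl incl (poly_ev w p) = f (incl p).
Proof.
move=> tfII sP.
have /choice[f fE] : forall g, exists x, int_tensor_eval x = int_subst g.
  by move=> g; apply/sum_of_productsP.
have e_inj := int_tensor_eval_inj tfII.
have f_lin : linear f.
  move=> a g h; apply: e_inj.
  by rewrite int_tensor_eval_linear !fE int_subst_linear.
have f_mon : monoid_morphism f.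
  split=> [|g h]; apply: e_inj; first by rewrite fE int_subst1 int_tensor_eval1.
  by rewrite int_tensor_evalM !fE int_substM.
pose fL := GRing.isLinear.Build D I (tensor I I) *:%R f f_lin.
pose fM := GRing.isMonoidMorphism.Build I (tensor I I) f f_mon.
pose g : {lrmorphism I -> tensor I I} := HB.pack f fL fM.
by exists g => p; apply: e_inj; rewrite int_subst_incl fE.
Qed.

End Substitution.

(** Evaluation at [a] with its value taken in D rather than K; it provides the co-linear structure
    on Int(D). *)
Definition int_horner (a : D) (f : I) : D :=
  projT1 (cid (int_valuedP _ (int_poly_valP f) a)).

Lemma int_hornerE a (f : I) : (int_horner a f)%:F = (f : {poly K}).[a%:F].
Proof. by rewrite /int_horner; case: cid. Qed.

Fact int_horner_linear a :
  scalable_for *%R (int_horner a) /\ zmod_morphism (int_horner a).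
Proof.
split=> [c f|f g]; apply: tofrac_inj.
  by rewrite tofracM !int_hornerE hornerZ.
by rewrite tofracB !int_hornerE hornerD hornerN.
Qed.

Fact int_horner_monoid a : monoid_morphism (int_horner a).
Proof.
split=> [|f g]; apply: tofrac_inj.
  by rewrite int_hornerE tofrac1 hornerC.
by rewrite tofracM !int_hornerE hornerM.
Qed.

HB.instance Definition _ a := GRing.isZmodMorphism.Build I D (int_horner a)
  (int_horner_linear a).2.
HB.instance Definition _ a := GRing.isScalable.Build D I D *%R (int_horner a)
  (int_horner_linear a).1.
HB.instance Definition _ a := GRing.isMonoidMorphism.Build I D (int_horner a)
  (int_horner_monoid a).

Lemma int_horner_incl a p : int_horner a (incl p) = p.[a].
Proof. by apply: tofrac_inj; rewrite int_hornerE horner_map. Qed.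

Fact int_reflect_valued (f : I) : (f : {poly K}) \Po (- 'X) \in @int_valued D.
Proof.
apply/int_valuedP => a; have /int_valuedP/(_ (- a))[b fb] := int_poly_valP f.
by exists b; rewrite horner_comp hornerN hornerX -rmorphN.
Qed.

(** The antipode f(X) |-> f(-X) of co-addition. *)
Definition int_reflect (f : I) : I := IntPoly (int_reflect_valued f).

Fact int_reflect_linear : linear int_reflect.
Proof.
by move=> a f g; apply: val_inj; rewrite /= comp_polyD comp_polyZ.
Qed.

Fact int_reflect_monoid : monoid_morphism int_reflect.
Proof.
split=> [|f g]; apply: val_inj => /=; first exact: comp_polyC.
by rewrite comp_polyM.
Qed.

HB.instance Definition _ :=
  GRing.isLinear.Build D I I *:%R int_reflect int_reflect_linear.
HB.instance Definition _ :=
  GRing.isMonoidMorphism.Build I I int_reflect int_reflect_monoid.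

(** By multiplicativity only p = 1 and p = X matter, and for X the law reads -X + X = 0. Co-addition
    appears through D[X], so the statement does not depend on its lift to Int(D). *)
Lemma int_reflect_antipode p :
  tlift (fun f g : I => int_reflect f * g) (tmap incl incl (poly_coadd D p))
  = (int_horner 0 (incl p))%:A.
Proof.
have bb : bilinear_for *:%R *:%R (fun f g : I => int_reflect f * g).
  split=> [t a x y|t a x y] /=; first by rewrite linearP mulrDl scalerAl.
  by rewrite mulrDr scalerAr.
have ml : mul_linear (tlift (fun f g : I => int_reflect f * g)) *%R *%R.
  apply: mul_linear_tlift; [exact: alg_mul_bilin | exact: bb |].
  by move=> s t s' t'; rewrite rmorphM mulrACA.
have tl := mul_linear_tmap incl incl.
move: p; apply: (@poly_hom_ext D I *%R).
- exact: linear_comp ml.1 (linear_comp tl.1 (linearP _)).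
- by move=> a p q; rewrite linearP /= linearP scalerDl scalerA.
- by move=> p q; rewrite rmorphM /= tl.2 ml.2.
- by move=> p q; rewrite !rmorphM /= -scalerAl mul1r scalerA.
- rewrite !rmorph1 tensor1E (tmapE incl incl) (tliftE bb) !rmorph1 mulr1.
  by rewrite scale1r.
- rewrite [poly_coadd D _]poly_evX linearD /= !(tmapE incl incl) (tliftD bb).
  rewrite !(tliftE bb) !rmorph1 mulr1 mul1r int_horner_incl hornerX scale0r.
  by apply: val_inj; rewrite /= map_polyX comp_polyX addNr.
Qed.

(** Flatness adds one tensor factor at a time; in the other case the factor D at the end of the
    second and third [tpow] is removed by a split injection. *)
Lemma tensor_powers_torsion_free :
  flat I \/ (forall n : nat, (n <= 4)%N -> torsion_free (tpow I n)) ->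
  torsion_free (tensor I I) /\ torsion_free (tensor I (tensor I I)).
Proof.
have tfI := @intPoly_torsion_free D.
case=> [flI|tfp].
  have tfII := flat_tensor_torsion_free flI tfI.
  by split=> //; apply: flat_tensor_torsion_free.
have tK := tmap_cancel (L := I) (@tunitK D I).
split.
  apply: torsion_free_inj (tmap_linear idfun (@tunit D I)) (can_inj tK) _.
  exact: (tfp 2).
apply: torsion_free_inj (tmap_linear idfun (tmap idfun (@tunit D I))) _ _.
  exact: can_inj (tmap_cancel (L := I) tK).
exact: (tfp 3).
Qed.

End CompatibleBiring.

Theorem theorem4 (D : idomainType)
    (hD : flat (intPoly D) \/
          (forall n : nat, (n <= 4)%N -> torsion_free (tpow (intPoly D) n))) :
  (forall B1 B2 : biring D (intPoly D),
     compatible B1 -> compatible B2 -> same_biring B1 B2)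
  /\ ((exists B : biring D (intPoly D), compatible B) <->
      (forall f : intPoly D,
         sum_of_products (poly_XaY (f : {poly {fraction D}})) /\
         sum_of_products (poly_XmY (f : {poly {fraction D}})))).
Proof.
have [tfII tfIII] := tensor_powers_torsion_free hD.
have tors := @int_incl_torsion D.
have tfD := @idomain_torsion_free D; have tfI := @intPoly_torsion_free D.
split=> [B1 B2|]; first exact: biring_hom_unique tors tfD tfII _ _.
have addE := int_tensor_eval_add_gen D; have mulE := int_tensor_eval_mul_gen D.
split=> [[B [aE mE _]] f|sP].
  (* [poly_coadd] and [poly_comul] are [poly_ev] at the generators in [addE] and [mulE], so
     compatibility of B has exactly the required form. *)
  split; first exact: int_subst_cooperation addE (coadd B) aE f.
  exact: int_subst_cooperation mulE (comul B) mE f.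
have [ca caE] := int_cooperation addE tfII (fun f => (sP f).1).
have [cm cmE] := int_cooperation mulE tfII (fun f => (sP f).2).
(* On D[X] the lifted co-addition is the polynomial one, so the antipode law there is already
   known. *)
have sigmaE p :
    tlift (fun f g : intPoly D => int_reflect f * g) (ca (int_incl p))
    = (int_horner 0 (int_incl p))%:A.
  by rewrite -caE; apply: int_reflect_antipode.
have colinE a p : int_horner a (int_incl p) = colin (poly_biring D) a p.
  exact: int_horner_incl.
exists (transfer_biring (BS := poly_biring D) tors tfD tfI tfII tfIII
  caE cmE colinE sigmaE).
exact: transfer_biring_hom.
Qed.
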